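(* Let $G \subset U(n)$ be a finite subgroup of fixity one. Then $G$ acts freely and smoothly on $\mathbb{S}^{2n-1}\times \mathbb{S}^{4n-5}$. In particular, if $G$ is any finite subgroup of $SU(3)$, then $G$ acts freely and smoothly on $\mathbb{S}^5\times\mathbb{S}^7$.
   Context: $U(n)$ is the group of $n\times n$ unitary matrices. For $0\le k\le n$, $U(k)$ is regarded as the subgroup of $U(n)$ consisting of the block matrices $\begin{pmatrix} A & 0\\ 0 & I_{n-k}\end{pmatrix}$ with $A\in U(k)$, where $I_{n-k}$ is the $(n-k)\times(n-k)$ identity matrix. A subgroup $G\subset U(n)$ acts on the homogeneous space $U(n)/U(k)$ by left translation. A finite subgroup $G\subset U(n)$ has fixity $f$ if $f$ is the smallest non-negative integer such that the induced action of $G$ on $U(n)/U(n-f-1)$ is free. *)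

(* Defs.v *)
From HB Require Import structures.
From mathcomp Require Import all_boot all_order all_algebra spectral.
From mathcomp Require Import complex.
From mathcomp Require Import all_classical all_reals all_analysis.

Set Implicit Arguments.
Unset Strict Implicit.
Unset Printing Implicit Defensive.

Import Order.TTheory GRing.Theory Num.Theory.
Import numFieldNormedType.Exports.

Local Open Scope classical_set_scope.
Local Open Scope ring_scope.

Section MatrixGroups.
Context {R : realType}.

Definition unitary_group (n : nat) : set 'M[R[i]]_n :=
  [set A | A \is unitarymx].
Arguments unitary_group : clear implicits.

Definition special_unitary_group (n : nat) : set 'M[R[i]]_n :=
  [set A | A \is unitarymx /\ \det A = 1].

Definition is_subgroup n (H G : set 'M[R[i]]_n) : Prop :=
  [/\ G `<=` H,
      G 1%:M,
      forall A B, G A -> G B -> G (A *m B) &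
      forall A, G A -> G (invmx A)].

(* The cast only serves to give the block matrix of size k + (n - k) the
   type 'M_n. *)
Definition block_unitary_group (k n : nat) (kn : (k <= n)%N) :
    set 'M[R[i]]_n :=
  [set castmx (subnKC kn, subnKC kn)
         (block_mx A 0 0 (1%:M : 'M[R[i]]_(n - k))) | A in unitary_group k].

Definition left_coset n (K : set 'M[R[i]]_n) (A : 'M[R[i]]_n) :
    set 'M[R[i]]_n :=
  [set A *m B | B in K].

(* U(n) / U(k), as the set of left cosets. *)
Definition homogeneous_space (k n : nat) (kn : (k <= n)%N) :
    set (set 'M[R[i]]_n) :=
  [set left_coset (block_unitary_group kn) A | A in unitary_group n].

Definition left_translation n (g : 'M[R[i]]_n) (C : set 'M[R[i]]_n) :
    set 'M[R[i]]_n :=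
  [set g *m B | B in C].

Definition is_free n (G : set 'M[R[i]]_n) (X : Type) (M : set X)
    (act : 'M[R[i]]_n -> X -> X) : Prop :=
  forall g x, G g -> M x -> act g x = x -> g = 1%:M.

(* The action of G on U(n) / U(n - f - 1) is free. *)
Definition free_at n (G : set 'M[R[i]]_n) (f : nat) : Prop :=
  is_free G (homogeneous_space (leq_subr f.+1 n)) (@left_translation n).

(* The bound f < n makes n - f - 1 a genuine (not truncated) difference. *)
Definition has_fixity n (G : set 'M[R[i]]_n) (f : nat) : Prop :=
  [/\ (f < n)%N, free_at G f & forall f', (f' < f)%N -> ~ free_at G f'].

End MatrixGroups.

Section Smoothness.
Context {R : realType} {V W : normedModType R}.

(* C^k maps on an open set U; in the finite-dimensional spaces considered
   here, quantifying over all directions v amounts to using the partial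
   derivatives. *)
Fixpoint is_Ck (k : nat) (U : set V) (f : V -> W) : Prop :=
  if k is k'.+1 then
    (forall x, U x -> differentiable f x) /\
    (forall v, is_Ck k' U ('D_v f))
  else forall x, U x -> {for x, continuous f}.

Definition smooth_on_open (U : set V) (f : V -> W) : Prop :=
  forall k, is_Ck k U f.

(* Smoothness on an arbitrary subset M (here an embedded submanifold): near
   each point of M, f is the restriction of a smooth map defined on an open
   subset of the ambient space. *)
Definition smooth_on (M : set V) (f : V -> W) : Prop :=
  forall x, M x -> exists (U : set V) (F : V -> W),
    [/\ open U, U x, smooth_on_open U F & forall y, M y -> U y -> f y = F y].

End Smoothness.

Section Actions.
Context {R : realType}.

(* Written out as a sum of squares because the library norm on row vectors is
   the sup norm. *)
Definition sphere (d : nat) : set 'rV[R]_d.+1 :=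
  [set x | \sum_i x 0 i ^+ 2 = 1].

(* For a discrete group G, an action is smooth iff every g in G acts by a
   smooth map. *)
Definition acts_freely_smoothly n (G : set 'M[R[i]]_n)
    (V : normedModType R) (M : set V) : Prop :=
  exists act : 'M[R[i]]_n -> V -> V,
    [/\ forall g x, G g -> M x -> M (act g x),
        forall x, M x -> act 1%:M x = x,
        forall g h x, G g -> G h -> M x -> act (g *m h) x = act g (act h x),
        forall g, G g -> smooth_on M (act g) &
        is_free G M act].

End Actions.

Arguments unitary_group R n : clear implicits.
Arguments special_unitary_group R n : clear implicits.
Arguments sphere R d : clear implicits.

(* Main.v *)
From HB Require Import structures.
Require Import Defs.
From mathcomp Require Import all_boot all_order all_algebra spectral.
From mathcomp Require Import complex.
From mathcomp Require Import all_classical all_reals all_analysis.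
From mathcomp Require Import ring zify.
Import Order.TTheory GRing.Theory Num.Theory.
Import numFieldNormedType.Exports.
Local Open Scope classical_set_scope.
Local Open Scope ring_scope.

(* Fixity one makes G act freely on the unit sphere bundle of xi + xi, where xi
   is the complex orthogonal complement of the tautological line over
   S^(2n-1): a point is (v, w1, w2) with v a unit vector and w1, w2 orthogonal
   to v, not both zero, so a group element fixing it fixes two independent
   vectors.  This bundle has an explicit trivialization.  Writing w1 + w2 j in
   H^n turns xi + xi into the quaternionic orthogonal complement of v, seen in
   the unit sphere of H^n.  The vectors v in C^n avoid the point e j, e being a
   fixed unit vector of C^n, so the quaternionic reflection carrying v to e j
   depends smoothly on v; it maps the complement of v isometrically onto that
   of e, which is H^(n-1).  In coordinates it is a rational map whose
   denominator 1 + |<e, v>|^2 never vanishes, so the transported action is given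
   by maps which are smooth on the whole ambient space. *)

Set Implicit Arguments.
Unset Strict Implicit.
Unset Printing Implicit Defensive.

(** * Calculus of smooth real- and complex-valued maps on a normed space *)

Section Smooth.
Context {R : realType}.
Implicit Types U V W : normedModType R.

Local Notation Ck k := (is_Ck k setT).

Lemma CkSP V W k (f : V -> W) :
  Ck k.+1 f <-> (forall x, differentiable f x) /\ (forall v, Ck k ('D_v f)).
Proof. by split=> -[df dvf]; split=> // x; exact: df. Qed.

(** The product and quotient rules need this: undifferentiated factors reappear in their
    derivatives. *)
Lemma Ck_pred V W k (f : V -> W) : Ck k.+1 f -> Ck k f.
Proof.
elim: k f => [|k IHk] f /CkSP[df dvf].
  by move=> x _; exact/differentiable_continuous/df.
by apply/CkSP; split=> // v; exact/IHk/dvf.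
Qed.

Lemma Ck_cst V W k (w : W) : Ck k (cst w : V -> W).
Proof.
elim: k w => [|k IHk] w; first by move=> x _; exact: cst_continuous.
apply/CkSP; split=> [x|v]; first exact: differentiable_cst.
rewrite (_ : 'D_v (cst w) = cst 0); first exact: IHk.
by apply/funext => x; rewrite derive_cst.
Qed.

Lemma Ck_linear V W k (f : V -> W) : linear f -> continuous f -> Ck k f.
Proof.
move=> lf cf; pose flM := GRing.isLinear.Build _ _ _ _ _ lf.
pose fL : {linear V -> W} := HB.pack f flM.
case: k => [x _|k]; first exact: cf.
have df x : differentiable f x by exact: (@linear_differentiable _ _ _ fL).
apply/CkSP; split=> // v.
rewrite (_ : 'D_v f = cst (f v)); first exact: Ck_cst.
by apply/funext => x; rewrite deriveE// (@diff_lin _ _ _ fL).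
Qed.

Lemma CkD V W k (f g : V -> W) : Ck k f -> Ck k g -> Ck k (f + g).
Proof.
elim: k f g => [|k IHk] f g.
  by move=> cf cg x _; apply: continuousD; [exact: cf | exact: cg].
move=> /CkSP[df dvf] /CkSP[dg dvg]; apply/CkSP; split=> [x|v].
  exact: differentiableD.
rewrite (_ : 'D_v (f + g) = 'D_v f + 'D_v g); first exact: IHk.
by apply/funext => x; rewrite deriveD//; exact: diff_derivable.
Qed.

Lemma CkM V k (f g : V -> R) : Ck k f -> Ck k g -> Ck k (f * g).
Proof.
elim: k f g => [|k IHk] f g.
  by move=> cf cg x _; apply: continuousM; [exact: cf | exact: cg].
move=> Cf Cg; move: (Cf) (Cg) => /CkSP[df dvf] /CkSP[dg dvg].
apply/CkSP; split=> [x|v]; first exact: differentiableM.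
rewrite (_ : 'D_v (f * g) = f * 'D_v g + g * 'D_v f).
  by apply: CkD; apply: IHk => //; exact: Ck_pred.
by apply/funext => x; rewrite deriveM//; exact: diff_derivable.
Qed.

(** The derivative is [- (1/f)^2 * 'D_v f], so the induction hypothesis applied to [1/f] itself
    closes the step. *)
Lemma CkV V k (f : V -> R) : (forall x, f x != 0) -> Ck k f ->
  Ck k (fun x => (f x)^-1).
Proof.
move=> f0; elim: k => [|k IHk].
  by move=> cf x _; apply: continuousV => //; exact: cf.
move=> Cf; move: (Cf) => /CkSP[df dvf]; apply/CkSP; split=> [x|v].
  exact: differentiableV.
have Ci := IHk (Ck_pred Cf).
rewrite (_ : 'D_v _ = cst (-1) * ((fun x => (f x)^-1) * (fun x => (f x)^-1)
   * 'D_v f)); first by do ?[apply: CkM => //]; exact: Ck_cst.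
apply/funext => x; rewrite deriveV//; last exact: diff_derivable.
by rewrite -[RHS]/(-1 * ((f x)^-1 * (f x)^-1 * 'D_v f x)) mulN1r scaleNr expr2 invfM.
Qed.

Lemma CkZl V W k (s : V -> R) (w : W) : Ck k s -> Ck k (fun x => s x *: w).
Proof.
elim: k s => [|k IHk] s.
  by move=> cs x _; apply: continuousZr_tmp; exact: cs.
move=> /CkSP[ds dvs]; apply/CkSP; split=> [x|v]; first exact: differentiableZl.
rewrite (_ : 'D_v _ = fun x => 'D_v s x *: w); first exact: IHk.
by apply/funext => x; rewrite deriveE ?diffZl ?deriveE//; exact: differentiableZl.
Qed.

Lemma Ck_pair U V W k (f : U -> V) (g : U -> W) :
  Ck k f -> Ck k g -> Ck k (fun x => (f x, g x)).
Proof.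
elim: k f g => [|k IHk] f g.
  by move=> cf cg x _; apply: cvg_pair; [exact: cf | exact: cg].
move=> /CkSP[df dvf] /CkSP[dg dvg]; apply/CkSP; split=> [x|v].
  exact: differentiable_pair.
rewrite (_ : 'D_v _ = fun x => ('D_v f x, 'D_v g x)); first exact: IHk.
apply/funext => x; rewrite !deriveE//; last exact: differentiable_pair.
by rewrite diff_pair.
Qed.

Definition smooth V W (f : V -> W) := smooth_on_open setT f.

Lemma smooth_restrict V W (M : set V) (f : V -> W) : smooth f -> smooth_on M f.
Proof.
move=> sf x Mx; exists setT, f; split=> //; exact: openT.
Qed.

Lemma smooth_rV V n (f : V -> 'rV[R]_n) :
  (forall j, smooth (fun x => f x 0 j)) -> smooth f.
Proof.
move=> sf k; rewrite (_ : f = \sum_j (fun x => f x 0 j *: delta_mx 0 j)).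
  by elim/big_ind: _ => [||j _]; [exact: Ck_cst | exact: CkD | exact/CkZl/sf].
by apply/funext => x; rewrite fct_sumE -row_sum_delta.
Qed.

(** Smoothness over the reals: holomorphy is not asked, so conjugation stays available. *)
Definition csmooth V (f : V -> R[i]) :=
  smooth (fun x => complex.Re (f x)) /\ smooth (fun x => complex.Im (f x)).

Lemma csmooth_cst V (z : R[i]) : csmooth (fun _ : V => z).
Proof. by split=> k; exact: Ck_cst. Qed.

Lemma csmoothD V (f g : V -> R[i]) :
  csmooth f -> csmooth g -> csmooth (fun x => f x + g x).
Proof.
move=> [fr fi] [gr gi]; split=> k.
  rewrite (_ : (fun _ => _) =
      (fun x => complex.Re (f x)) + (fun x => complex.Re (g x))).
    exact: CkD.
  by apply/funext => x; rewrite raddfD.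
rewrite (_ : (fun _ => _) =
    (fun x => complex.Im (f x)) + (fun x => complex.Im (g x))).
  exact: CkD.
by apply/funext => x; rewrite raddfD.
Qed.

Lemma csmoothM V (f g : V -> R[i]) :
  csmooth f -> csmooth g -> csmooth (fun x => f x * g x).
Proof.
move=> [fr fi] [gr gi]; split=> k.
  rewrite (_ : (fun _ => _) =
      (fun x => complex.Re (f x)) * (fun x => complex.Re (g x))
      + cst (-1) * ((fun x => complex.Im (f x)) * (fun x => complex.Im (g x)))).
    by apply: CkD; [exact: CkM | apply: CkM; [exact: Ck_cst | exact: CkM]].
  apply/funext => x; case E: (f x) => [a b]; case E' : (g x) => [c d] /=.
  by rewrite /GRing.add /GRing.mul /= E E' mulN1r.
rewrite (_ : (fun _ => _) =
      (fun x => complex.Re (f x)) * (fun x => complex.Im (g x))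
      + (fun x => complex.Im (f x)) * (fun x => complex.Re (g x))).
  by apply: CkD; exact: CkM.
apply/funext => x; case E: (f x) => [a b]; case E' : (g x) => [c d] /=.
by rewrite /GRing.add /GRing.mul /= E E'.
Qed.

Lemma csmooth_conj V (f : V -> R[i]) : csmooth f -> csmooth (fun x => (f x)^*).
Proof.
move=> [fr fi]; split=> k.
  rewrite (_ : (fun _ => _) = (fun x => complex.Re (f x))); first exact: fr.
  by apply/funext => x; case: (f x).
rewrite (_ : (fun _ => _) = cst (-1) * (fun x => complex.Im (f x))).
  by apply: CkM; [exact: Ck_cst | exact: fi].
by apply/funext => x; case E: (f x); rewrite /GRing.mul /= E mulN1r.
Qed.

(** Rests on [1 / (a + i b) = (a - i b) / (a^2 + b^2)], which reduces the claim to a real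
    inverse. *)
Lemma csmoothV V (f : V -> R[i]) : (forall x, f x != 0) -> csmooth f ->
  csmooth (fun x => (f x)^-1).
Proof.
move=> f0 [fr fi].
pose a x := complex.Re (f x); pose b x := complex.Im (f x).
have nb k : Ck k (fun x => ((a * a + b * b) x)^-1).
  apply: CkV; last by apply: CkD; exact: CkM.
  move=> x; move: (f0 x); rewrite eq_complex.
  rewrite -[(_ + _ : V -> R) x]/(a x * a x + b x * b x).
  by rewrite -!expr2 paddr_eq0 ?sqr_ge0// !sqrf_eq0.
split=> k.
  rewrite (_ : (fun _ => _) = a * (fun x => ((a * a + b * b) x)^-1)).
    by apply: CkM; [exact: fr | exact: nb].
  apply/funext => x; case E: (f x) => [c d].
  by rewrite {1}/GRing.inv /= /GRing.mul /GRing.add /= /a /b E /= -!expr2.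
rewrite (_ : (fun _ => _) = cst (-1) * (b * (fun x => ((a * a + b * b) x)^-1))).
  by apply: CkM; [exact: Ck_cst | apply: CkM; [exact: fi | exact: nb]].
apply/funext => x; case E: (f x) => [c d].
by rewrite {1}/GRing.inv /= /GRing.mul /GRing.add /= /a /b E /= -!expr2 mulN1r.
Qed.

Lemma csmooth_sum V (I : finType) (f : I -> V -> R[i]) :
  (forall i, csmooth (f i)) -> csmooth (fun x => \sum_i f i x).
Proof.
move=> sf; suff : csmooth (\sum_i f i).
  by congr csmooth; apply/funext => x; rewrite fct_sumE.
by elim/big_ind: _ => [|u v|i _]; [exact: csmooth_cst | exact: csmoothD | exact: sf].
Qed.

End Smooth.

(** * The standard Hermitian form on column vectors *)

Section HermitianDot.
Context {C : numClosedFieldType}.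
Local Open Scope sesquilinear_scope.

Definition hdot n (u w : 'cV[C]_n) : C := \sum_i (u i 0)^* * w i 0.

Lemma hdotE n (u w : 'cV[C]_n) : hdot u w = (u ^t* *m w) 0 0.
Proof. by rewrite mxE; apply: eq_bigr => i _; rewrite !mxE. Qed.

Lemma hdotDr n (u w x : 'cV[C]_n) : hdot u (w + x) = hdot u w + hdot u x.
Proof. by rewrite -big_split; apply: eq_bigr => i _; rewrite mxE mulrDr. Qed.

Lemma hdotZr n (u w : 'cV[C]_n) a : hdot u (a *: w) = a * hdot u w.
Proof. by rewrite mulr_sumr; apply: eq_bigr => i _; rewrite mxE mulrCA. Qed.

Lemma hdot_conj n (u w : 'cV[C]_n) : (hdot u w)^* = hdot w u.
Proof.
by rewrite rmorph_sum; apply: eq_bigr => i _; rewrite rmorphM /= conjCK mulrC.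
Qed.

Lemma hdotNr n (u w : 'cV[C]_n) : hdot u (- w) = - hdot u w.
Proof. by rewrite -scaleN1r hdotZr mulN1r. Qed.

Lemma hdotDl n (u w x : 'cV[C]_n) : hdot (w + x) u = hdot w u + hdot x u.
Proof. by rewrite -hdot_conj hdotDr rmorphD /= !hdot_conj. Qed.

Lemma hdotNl n (u w : 'cV[C]_n) : hdot (- w) u = - hdot w u.
Proof. by rewrite -hdot_conj hdotNr rmorphN /= hdot_conj. Qed.

Lemma hdotZl n (u w : 'cV[C]_n) a : hdot (a *: w) u = a^* * hdot w u.
Proof. by rewrite -hdot_conj hdotZr rmorphM /= hdot_conj. Qed.

Lemma hdot_ge0 n (u : 'cV[C]_n) : 0 <= hdot u u.
Proof. by apply: sumr_ge0 => i _; rewrite mulrC mul_conjC_ge0. Qed.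

Lemma hdot_eq0 n (u : 'cV[C]_n) : (hdot u u == 0) = (u == 0).
Proof.
apply/eqP/eqP => [/psumr_eq0P u0|->]; last first.
  by rewrite /hdot big1// => i _; rewrite mxE mulr0.
apply/colP => i; rewrite mxE; apply/eqP.
rewrite -mul_conjC_eq0 mulrC u0// => j _.
by rewrite mulrC mul_conjC_ge0.
Qed.

Lemma hdot_unitary n (g : 'M[C]_n) (u w : 'cV[C]_n) : g \is unitarymx ->
  hdot (g *m u) (g *m w) = hdot u w.
Proof.
move=> gU; rewrite !hdotE trmx_mul map_mxM mulmxA mulmxKtV//.
Qed.

End HermitianDot.

(** * The quaternionic reflection carrying [v] to [e j], and its inverse *)

Section QuaternionicReflection.
Context {C : numClosedFieldType} {n : nat}.
Implicit Types (e v w : 'cV[C]_n) (X : 'cV[C]_n * 'cV[C]_n).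

Definition hdot2 X := hdot X.1 X.1 + hdot X.2 X.2.

(* (w1, w2) stands for the quaternionic vector w1 + w2 j, and
   qshift e v a b subtracts (v - e j)(a + b j) from it. *)
Definition qshift e v (a b : C) X :=
  (X.1 - a *: v - b^* *: e, X.2 - b *: v + a^* *: e).

(** The squared norm of the quaternion [1 - <v, e j>]. With [c = hdot v e] one has [<v, e j> = c j],
    a pure quaternion, so [(1 - c j)^-1 = (1 + c j) / qdenom e v]. *)
Definition qdenom e v := 1 + hdot e v * hdot v e.

(* The reflection x |-> x - (v - e j) (1 - <e j, v>)^-1 <v - e j, x>, taking v
   to e j, in the form it takes on the vectors x orthogonal to v. *)
Definition to_pole e v X :=
  let c := hdot v e in let z1 := hdot e X.1 in let z2 := hdot e X.2 in
  qshift e v ((c * z1 - z2^*) / qdenom e v) ((z1^* + c * z2) / qdenom e v) X.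

(* The inverse reflection, in the form x |-> x - (v - e j) (1 - <v, e j>)^-1 <v, x>
   it takes on the vectors x orthogonal to e. *)
Definition from_pole e v X :=
  let c := hdot v e in let s := hdot v X.1 in let t := hdot v X.2 in
  qshift e v ((s - c * t^*) / qdenom e v) ((t + c * s^*) / qdenom e v) X.

(** Quaternionic orthogonality to the complex vector [v], because
    [<v, w1 + w2 j> = <v, w1> + <v, w2> j]. *)
Definition orthogonal2 v X := hdot v X.1 = 0 /\ hdot v X.2 = 0.

Lemma qdenom_neq0 e v : qdenom e v != 0.
Proof.
by rewrite gt_eqF// ltr_pwDl ?ltr01// -(hdot_conj e) mul_conjC_ge0.
Qed.

Lemma qdenom_conj e v : (qdenom e v)^* = qdenom e v.
Proof. by rewrite rmorphD rmorph1 rmorphM /= !hdot_conj mulrC. Qed.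

Variables (e v : 'cV[C]_n).
Hypotheses (e1 : hdot e e = 1) (v1 : hdot v v = 1).

Lemma orthogonal2_conj w X : orthogonal2 w X -> hdot X.1 w = 0 /\ hdot X.2 w = 0.
Proof. by move=> [h1 h2]; rewrite -hdot_conj h1 -(hdot_conj w) h2 rmorph0. Qed.

(** Turns a claim about the reflections into a rational identity between the products of [e], [v],
    [X.1], [X.2]. Conjugations are pushed inwards in several rounds because they nest. *)
Local Ltac expand_hdot :=
  rewrite /to_pole /from_pole /qshift /hdot2 /=;
  rewrite ?(hdotDr, hdotNr, hdotZr, hdotDl, hdotNl, hdotZl) /=;
  do 4 rewrite ?(fmorphV, rmorphM, rmorphB, rmorphD, rmorphN, conjCK) /=;
  rewrite ?(hdot_conj, qdenom_conj).

Local Ltac qdenom_tac :=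
  first [exact: qdenom_neq0 | rewrite mulrC; exact: qdenom_neq0].

(** The coefficient [q] of [v - e j] solves [<e j, x - (v - e j) q> = 0] for every [x]; likewise for
    [from_pole] with [v] in place of [e j]. *)
Lemma to_pole_orthogonal X : orthogonal2 e (to_pole e v X).
Proof. by split; expand_hdot; rewrite e1 /qdenom; field; qdenom_tac. Qed.

Lemma from_pole_orthogonal X : orthogonal2 v (from_pole e v X).
Proof. by split; expand_hdot; rewrite v1 /qdenom; field; qdenom_tac. Qed.

(** Both reflections move a vector along [v - e j], so inverting one by the other amounts to
    checking that their coefficients are opposite. *)
Lemma qshiftK a b a' b' X : a' = - a -> b' = - b ->
  qshift e v a' b' (qshift e v a b X) = X.
Proof.
move=> -> ->; case: X => X1 X2; rewrite /qshift /= !rmorphN !scaleNr !opprK.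
by congr pair; [rewrite addrAC addrNK addrNK| rewrite addrAC addrK addrNK].
Qed.

Lemma to_poleK X : orthogonal2 v X -> from_pole e v (to_pole e v X) = X.
Proof.
move=> oX; have [ov1 ov2] := oX; have [vo1 vo2] := orthogonal2_conj oX.
by apply: qshiftK; expand_hdot;
  rewrite ?e1 ?v1 ?ov1 ?ov2 ?vo1 ?vo2 /qdenom; field; qdenom_tac.
Qed.

Lemma from_poleK X : orthogonal2 e X -> to_pole e v (from_pole e v X) = X.
Proof.
move=> oX; have [oe1 oe2] := oX; have [eo1 eo2] := orthogonal2_conj oX.
by apply: qshiftK; expand_hdot;
  rewrite ?e1 ?v1 ?oe1 ?oe2 ?eo1 ?eo2 /qdenom; field; qdenom_tac.
Qed.

Lemma to_pole_hdot2 X : orthogonal2 v X -> hdot2 (to_pole e v X) = hdot2 X.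
Proof.
move=> oX; have [ov1 ov2] := oX; have [vo1 vo2] := orthogonal2_conj oX.
by expand_hdot; rewrite ?e1 ?v1 ?ov1 ?ov2 ?vo1 ?vo2 /qdenom; field; qdenom_tac.
Qed.

Lemma from_pole_hdot2 X : orthogonal2 e X -> hdot2 (from_pole e v X) = hdot2 X.
Proof.
move=> oX; have [oe1 oe2] := oX; have [eo1 eo2] := orthogonal2_conj oX.
by expand_hdot; rewrite ?e1 ?v1 ?oe1 ?oe2 ?eo1 ?eo2 /qdenom; field; qdenom_tac.
Qed.

End QuaternionicReflection.

(** * Unitary matrices that fix an orthonormal frame *)

Section FixedFrames.
Context {C : numClosedFieldType}.
Local Open Scope sesquilinear_scope.

Lemma unitarymx_mulC n (A : 'M[C]_n) : A \is unitarymx -> A ^t* *m A = 1%:M.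
Proof. by move=> AU; rewrite -[LHS]mul1mx mulmxA mulmxKtV. Qed.

(** [W] is the adjoint of a Schmidt orthonormal basis of the complement of the frame, which has rank
    [k]. *)
Lemma frame_complete k m (V : 'M[C]_(k + m, m)) : V ^t* *m V = 1%:M ->
  exists W : 'M[C]_(k + m, k), row_mx W V \is unitarymx.
Proof.
move=> V1; have VU : V ^t* \is unitarymx by apply/unitarymxP; rewrite trmxCK.
pose O := orthomx Num.conj (mx_of_hermitian (hermitian1mx _)) (V ^t*).
have rkO : \rank O = k.
  by rewrite [LHS]rank_ortho mxrank_unitary// addnK.
have : schmidt (row_base O) \is unitarymx by rewrite schmidt_unitarymx ?rank_leq_col.
have : schmidt (row_base O) *m V = 0.
  have: (schmidt (row_base O) <= O)%MS.
    by rewrite eqmx_schmidt_free ?eq_row_base ?row_base_free.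
  by move/orthomx1P; rewrite trmxCK.
(* The matrix is generalised first because [\rank O] occurs in its type. *)
move: (schmidt (row_base O)); rewrite rkO => U UV UU.
exists (U ^t*); rewrite -trmxC_unitary; apply/unitarymxP.
rewrite trmxCK tr_row_mx map_col_mx mul_col_row trmxCK V1 UV (unitarymxP UU).
have -> : V ^t* *m U ^t* = 0.
  by rewrite -map_mxM -trmx_mul UV trmx0 map_mx0.
by rewrite -scalar_mx_block.
Qed.

(** In an orthonormal basis ending with the frame [V], [g] fixes the last [m] vectors and, being
    unitary, preserves their complement. *)
Lemma fixed_frame_block k m (g : 'M[C]_(k + m)) (V : 'M[C]_(k + m, m)) :
  g \is unitarymx -> V ^t* *m V = 1%:M -> g *m V = V ->
  exists (A : 'M[C]_(k + m)) (B : 'M[C]_k), [/\ A \is unitarymx, B \is unitarymx &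
    g *m A = A *m block_mx B 0 0 1%:M].
Proof.
move=> gU V1 gV; have [W AU] := frame_complete V1; set A := row_mx W V in AU.
(* The adjoint of [g *m V = V], multiplied by [g]; it makes the lower left block vanish. *)
have gVt : V ^t* *m g = V ^t*.
  by rewrite -[in LHS]gV trmx_mul map_mxM mulmxKtV.
have := unitarymx_mulC AU.
rewrite /A tr_row_mx map_col_mx mul_col_row V1 scalar_mx_block.
move=> /eq_block_mx [W1 WV VW _].
have gE : A ^t* *m (g *m A) = block_mx (W ^t* *m g *m W) 0 0 1%:M.
  rewrite mulmxA /A tr_row_mx map_col_mx mul_col_mx mul_col_row gVt VW V1.
  by rewrite -(mulmxA _ g V) gV WV.
have BU : A ^t* *m (g *m A) \is unitarymx.
  by rewrite mul_unitarymx ?trmxC_unitary// mul_unitarymx.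
exists A, (W ^t* *m g *m W); split=> //.
  move: BU; rewrite gE => /unitarymxP.
  rewrite tr_block_mx map_block_mx !trmx0 !map_mx0 mulmx_block !mulmx0 !mul0mx.
  rewrite !addr0 scalar_mx_block => /eq_block_mx[BB _ _ _].
  exact/unitarymxP.
by rewrite -gE mulmxA (unitarymxP AU) mul1mx.
Qed.

(** A frame of codimension one leaves a block [B] of size 1, whose entry is [\det g]. *)
Lemma det_fixed_frame (m : nat) (g : 'M[C]_m.+1) (V : 'M[C]_(m.+1, m)) :
  g \is unitarymx -> \det g = 1 -> V ^t* *m V = 1%:M -> g *m V = V -> g = 1%:M.
Proof.
move=> gU g1 V1 gV.
have [A [B [AU _ gA]]] := @fixed_frame_block 1 m g V gU V1 gV.
have Au := unitarymx_unit AU.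
suff B1 : B = 1%:M.
  rewrite B1 -scalar_mx_block mulmx1 in gA.
  by rewrite -[g](mulmxK Au) gA mulmxV.
have : \det (g *m A) = \det (A *m block_mx B 0 0 1%:M) by rewrite gA.
rewrite !det_mulmx g1 mul1r det_ublock det1 mulr1 det_mx11 => /esym.
rewrite -[RHS]mulr1 => /mulfI B00; apply/matrixP => i j; rewrite !ord1 B00 ?mxE//.
by rewrite -unitfE -unitmxE.
Qed.

End FixedFrames.

(** * From freeness on cosets to the absence of fixed 2-frames *)

Section Fixity.
Context {R : realType}.
Local Open Scope sesquilinear_scope.

(** If [g] fixes a frame of [n - k] vectors, then [g *m A = A *m diag(B, 1)] with [B] in [U(k)], so
    [g] fixes the coset [A U(k)]. *)
Lemma free_fixed_frame n k (kn : (k <= n)%N) (G : set 'M[R[i]]_n) :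
  G `<=` unitary_group R n ->
  is_free G (homogeneous_space kn) (@left_translation R n) ->
  forall g (V : 'M[R[i]]_(n, n - k)), G g -> V ^t* *m V = 1%:M -> g *m V = V ->
  g = 1%:M.
Proof.
rewrite /homogeneous_space /block_unitary_group.
(* With [n - k] generalised to [m], the equation [k + m = n] can be eliminated and the cast becomes
   trivial. *)
move: (subnKC kn); move: (n - k)%N => m e; case: n / e G {kn} => G GU freeG.
move=> g V Gg V1 gV.
have [A [B [AU BU gA]]] := fixed_frame_block (GU _ Gg) V1 gV.
apply: (freeG g (left_coset _ A)) => //; first by exists A.
have eqK (D : 'M[R[i]]_k) : castmx (erefl, erefl) (block_mx D 0 0 (1%:M : 'M[R[i]]_m))
   = block_mx D 0 0 1%:M by rewrite castmx_id.
have mulblock (D E : 'M[R[i]]_k) :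
    block_mx D 0 0 1%:M *m block_mx E 0 0 (1%:M : 'M[R[i]]_m)
   = block_mx (D *m E) 0 0 1%:M.
  by rewrite mulmx_block !mulmx0 !mul0mx !addr0 add0r mulmx1.
apply/seteqP; split=> [_ [_ [_ [D DU <-] <-] <-]|_ [_ [D DU <-] <-]].
  rewrite mulmxA gA -mulmxA eqK mulblock; eexists; last by [].
  by exists (B *m D); rewrite ?eqK//; exact: mul_unitarymx.
(* Left multiplication by [g] replaces [D] by [B *m D], so [B ^t* *m D] gives the preimage. *)
exists (A *m block_mx (B ^t* *m D) 0 0 1%:M).
  eexists; last by []; exists (B ^t* *m D); last exact: eqK.
  by apply: mul_unitarymx; rewrite ?trmxC_unitary.
by rewrite mulmxA gA -mulmxA mulblock eqK mulmxA (unitarymxP BU) mul1mx.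
Qed.

(** The common consequence of fixity one and of [G] lying in [SU(3)] on which freeness of the action
    rests. *)
Definition fixes_no_2frame n (G : set 'M[R[i]]_n) := forall g (v w : 'cV_n),
  G g -> hdot v v = 1 -> hdot w w = 1 -> hdot v w = 0 ->
  g *m v = v -> g *m w = w -> g = 1%:M.

Lemma frame2P n (v w : 'cV[R[i]]_n) :
  hdot v v = 1 -> hdot w w = 1 -> hdot v w = 0 ->
  (row_mx v w) ^t* *m row_mx v w = 1%:M.
Proof.
move=> v1 w1 vw; rewrite tr_row_mx map_col_mx mul_col_row [RHS]scalar_mx_block.
by congr block_mx; apply/matrixP => i j;
  rewrite !ord1 -hdotE ?mxE//= -hdot_conj vw rmorph0.
Qed.

Lemma fixity1_no_2frame n (G : set 'M[R[i]]_n) :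
  is_subgroup (unitary_group R n) G -> has_fixity G 1 -> fixes_no_2frame G.
Proof.
move=> [GU _ _ _] [n1 freeG _] g v w Gg v1 w1 vw gv gw.
(* Relies on the bound [1 < n] from [has_fixity], since subtraction is truncated. *)
have e : 2 = (n - (n - 2))%N by rewrite subKn.
apply: (free_fixed_frame GU freeG (V := castmx (erefl, e) (row_mx v w))) => //.
  by case: _ / e; rewrite castmx_id frame2P.
by case: _ / e; rewrite castmx_id mul_mx_row gv gw.
Qed.

Lemma SU3_no_2frame (G : set 'M[R[i]]_3) :
  is_subgroup (special_unitary_group R 3) G -> fixes_no_2frame G.
Proof.
move=> [GU _ _ _] g v w Gg v1 w1 vw gv gw; have [gU g1] := GU _ Gg.
have gV : g *m row_mx v w = row_mx v w by rewrite mul_mx_row gv gw.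
exact: (det_fixed_frame gU g1 (frame2P v1 w1 vw) gV).
Qed.

End Fixity.

(** * The action on the trivialised sphere bundle *)

Section ModelAction.
Context {C : numClosedFieldType} {n : nat}.
Variable e : 'cV[C]_n.
Hypothesis e1 : hdot e e = 1.

(** A product of two spheres: the condition on [p.2] involves the fixed vector [e] and not [p.1]. *)
Definition model : set ('cV[C]_n * ('cV[C]_n * 'cV[C]_n)) :=
  [set p | [/\ hdot p.1 p.1 = 1, orthogonal2 e p.2 & hdot2 p.2 = 1]].

Definition mulmx2 (g : 'M[C]_n) (X : 'cV[C]_n * 'cV[C]_n) := (g *m X.1, g *m X.2).

(** The linear action on [(v, X)], conjugated by the trivialisation, which is taken at [v] on the
    source and at [g *m v] on the target. *)
Definition model_act (g : 'M[C]_n) (p : 'cV[C]_n * ('cV[C]_n * 'cV[C]_n)) :=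
  (g *m p.1, to_pole e (g *m p.1) (mulmx2 g (from_pole e p.1 p.2))).

Lemma orthogonal2_unitary g v X : g \is unitarymx -> orthogonal2 v X ->
  orthogonal2 (g *m v) (mulmx2 g X).
Proof. by move=> gU [X1 X2]; split; rewrite hdot_unitary. Qed.

Lemma hdot2_unitary g X : g \is unitarymx -> hdot2 (mulmx2 g X) = hdot2 X.
Proof. by move=> gU; rewrite /hdot2 !hdot_unitary. Qed.

Lemma model_act_closed g p : g \is unitarymx -> model p -> model (model_act g p).
Proof.
move=> gU [p1 oY Y1]; have gp1 : hdot (g *m p.1) (g *m p.1) = 1.
  by rewrite hdot_unitary.
have oX := orthogonal2_unitary gU (from_pole_orthogonal e p1 p.2).
split=> //=; first exact: to_pole_orthogonal.
by rewrite to_pole_hdot2// hdot2_unitary// from_pole_hdot2.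
Qed.

Lemma model_act1 p : model p -> model_act 1%:M p = p.
Proof.
case: p => v Y [/= v1 oY _]; rewrite /model_act /mulmx2 !mul1mx [p in p.1]/=.
by rewrite -surjective_pairing from_poleK.
Qed.

(** In the composite, the reflections at the intermediate base point [h *m p.1] cancel. *)
Lemma model_actM g h p : h \is unitarymx -> model p ->
  model_act (g *m h) p = model_act g (model_act h p).
Proof.
move=> hU [p1 oY _]; rewrite /model_act /= !mulmxA to_poleK ?hdot_unitary//.
  by rewrite /mulmx2 /= !mulmxA.
exact/orthogonal2_unitary/from_pole_orthogonal.
Qed.

Lemma hdot_normalize (v w : 'cV[C]_n) g : w != 0 -> hdot v w = 0 -> g *m w = w ->
  exists w', [/\ hdot w' w' = 1, hdot v w' = 0 & g *m w' = w'].
Proof.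
move=> w0 vw gw; set s := sqrtC (hdot w w).
have s0 : s != 0 by rewrite sqrtC_eq0 hdot_eq0.
exists (s^-1 *: w); split; last by rewrite -scalemxAr gw.
  have sR : s^* = s by apply/CrealP; rewrite ger0_real// sqrtC_ge0 hdot_ge0.
  rewrite hdotZr hdotZl fmorphV /= sR mulrA -invfM -expr2 sqrtCK mulVf//.
  by rewrite hdot_eq0.
by rewrite hdotZr vw mulr0.
Qed.

Lemma model_act_free g p : g \is unitarymx -> model p -> model_act g p = p ->
  exists w, [/\ hdot w w = 1, hdot p.1 w = 0, g *m p.1 = p.1 & g *m w = w].
Proof.
case: p => v Y gU [/= v1 oY Y1] [gv]; rewrite gv => gY.
set X := from_pole e v Y in gY.
have oX : orthogonal2 v X by exact: from_pole_orthogonal.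
have gX : mulmx2 g X = X.
  (* Since [g] fixes the base point [v], applying [from_pole e v] to [gY] gives the claim. *)
  rewrite /X -[in RHS]gY to_poleK//.
  by rewrite -{1}gv; exact: orthogonal2_unitary.
have X1 : hdot2 X = 1 by rewrite from_pole_hdot2.
case: X oX gX X1 {gY} => [X1 X2] [/= vX1 vX2] [gX1 gX2] X1X2.
(* As [hdot2 X = 1], one component of [X] is nonzero; normalised, it is the required [w]. *)
have [X10|/hdot_normalize/(_ vX1 gX1)[w [w1 vw gw]]] := eqVneq X1 0; last by exists w.
have [X20|/hdot_normalize/(_ vX2 gX2)[w [w1 vw gw]]] := eqVneq X2 0; last by exists w.
have z : hdot (0 : 'cV[C]_n) 0 = 0 by apply/eqP; rewrite hdot_eq0.
by move/eqP: X1X2; rewrite /hdot2 X10 X20 /= z addr0 eq_sym oner_eq0.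
Qed.

End ModelAction.

(** * Identification of complex vectors with real row vectors *)

Section Coordinates.
Context {R : realType}.

(** The equation [e] leaves [d] free to be a successor, the form in which [sphere] gives its ambient
    dimension. *)
Definition complexify n d (e : (n + n)%N = d) (x : 'rV[R]_d) : 'cV[R[i]]_n :=
  \col_a Complex (x 0 (cast_ord e (lshift n a))) (x 0 (cast_ord e (rshift n a))).

Definition realify n d (e : (n + n)%N = d) (z : 'cV[R[i]]_n) : 'rV[R]_d :=
  \row_j match fintype.split (cast_ord (esym e) j) with
         | inl a => complex.Re (z a 0)
         | inr a => complex.Im (z a 0)
         end.

Lemma complexifyK n d (e : (n + n)%N = d) : cancel (complexify e) (realify e).
Proof.
move=> x; apply/rowP => j; rewrite mxE.
case: d / e j x => j x; rewrite cast_ord_id.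
by case: split_ordP => a ->; rewrite mxE /= cast_ord_id.
Qed.

Lemma realifyK n d (e : (n + n)%N = d) : cancel (realify e) (complexify e).
Proof.
move=> z; apply/colP => a; rewrite mxE.
case: d / e; rewrite !mxE !cast_ord_id.
rewrite (unsplitK (inl a)) (unsplitK (inr a)).
by case: (z a 0).
Qed.

Lemma hdot_complexify n d (e : (n + n)%N = d) (x : 'rV[R]_d) :
  hdot (complexify e x) (complexify e x) = Complex (\sum_j x 0 j ^+ 2) 0.
Proof.
case: d / e x => x; rewrite big_split_ord /= -big_split /=.
rewrite /hdot.
rewrite -[RHS]/((\sum_i (x 0 (lshift n i) ^+ 2 + x 0 (rshift n i) ^+ 2))%:C)%C.
rewrite rmorph_sum; apply: eq_bigr => a _.
rewrite mxE !cast_ord_id mulrC -normCK -add_Re2_Im2 //.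
Qed.

Lemma sphereP n d (e : (n + n)%N = d.+1) (x : 'rV[R]_d.+1) :
  sphere R d x <-> hdot (complexify e x) (complexify e x) = 1.
Proof. by rewrite hdot_complexify; split=> [->|[]]. Qed.

End Coordinates.

(** * Smoothness of vector-valued maps and of the two reflections *)

Section SmoothVectors.
Context {R : realType} {V : normedModType R}.

Definition vsmooth n (F : V -> 'cV[R[i]]_n) :=
  forall a, csmooth (fun x => F x a 0).

Lemma vsmooth_cst n (w : 'cV[R[i]]_n) : vsmooth (fun=> w).
Proof. by move=> a; exact: csmooth_cst. Qed.

Lemma vsmoothD n (F F' : V -> 'cV[R[i]]_n) : vsmooth F -> vsmooth F' ->
  vsmooth (fun x => F x + F' x).
Proof.
move=> sF sF' a; rewrite (_ : (fun _ => _) = fun x => F x a 0 + F' x a 0).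
  exact: csmoothD.
by apply/funext => x; rewrite mxE.
Qed.

Lemma vsmoothZ n (f : V -> R[i]) (F : V -> 'cV[R[i]]_n) : csmooth f -> vsmooth F ->
  vsmooth (fun x => f x *: F x).
Proof.
move=> sf sF a; rewrite (_ : (fun _ => _) = fun x => f x * F x a 0).
  exact: csmoothM.
by apply/funext => x; rewrite mxE.
Qed.

Lemma vsmooth_mulmx m n (A : 'M[R[i]]_(m, n)) (F : V -> 'cV[R[i]]_n) : vsmooth F ->
  vsmooth (fun x => A *m F x).
Proof.
move=> sF a; rewrite (_ : (fun _ => _) = fun x => \sum_j A a j * F x j 0).
  by apply: csmooth_sum => j; apply: csmoothM => //; exact: csmooth_cst.
by apply/funext => x; rewrite mxE.
Qed.

Lemma csmooth_hdot n (F F' : V -> 'cV[R[i]]_n) : vsmooth F -> vsmooth F' ->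
  csmooth (fun x => hdot (F x) (F' x)).
Proof.
by move=> sF sF'; apply: csmooth_sum => j; apply: csmoothM => //; exact: csmooth_conj.
Qed.

Lemma csmoothB (f g : V -> R[i]) : csmooth f -> csmooth g ->
  csmooth (fun x => f x - g x).
Proof.
move=> sf sg; rewrite (_ : (fun _ => _) = fun x => f x + (-1) * g x).
  by apply: csmoothD => //; apply: csmoothM => //; exact: csmooth_cst.
by apply/funext => x; rewrite mulN1r.
Qed.

Lemma vsmoothB n (F F' : V -> 'cV[R[i]]_n) : vsmooth F -> vsmooth F' ->
  vsmooth (fun x => F x - F' x).
Proof.
move=> sF sF' a; rewrite (_ : (fun _ => _) = fun x => F x a 0 - F' x a 0).
  exact: csmoothB.
by apply/funext => x; rewrite !mxE.
Qed.

Definition vsmooth2 n (X : V -> 'cV[R[i]]_n * 'cV[R[i]]_n) :=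
  vsmooth (fun x => (X x).1) /\ vsmooth (fun x => (X x).2).

Variables (n : nat) (e : 'cV[R[i]]_n) (v : V -> 'cV[R[i]]_n).
Variable (X : V -> 'cV[R[i]]_n * 'cV[R[i]]_n).
Hypotheses (sv : vsmooth v) (sX : vsmooth2 X).

Lemma vsmooth2_qshift (a b : V -> R[i]) : csmooth a -> csmooth b ->
  vsmooth2 (fun x => qshift e (v x) (a x) (b x) (X x)).
Proof.
move=> sa sb; have [sX1 sX2] := sX; split=> /=.
  apply: vsmoothB; first by apply: vsmoothB => //; exact: vsmoothZ.
  by apply: vsmoothZ; [exact: csmooth_conj | exact: vsmooth_cst].
apply: vsmoothD; first by apply: vsmoothB => //; exact: vsmoothZ.
by apply: vsmoothZ; [exact: csmooth_conj | exact: vsmooth_cst].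
Qed.

Lemma csmooth_div_qdenom (f : V -> R[i]) : csmooth f ->
  csmooth (fun x => f x / qdenom e (v x)).
Proof.
move=> sf; apply: csmoothM => //; apply: csmoothV => [x|]; first exact: qdenom_neq0.
apply: csmoothD; first exact: csmooth_cst.
by apply: csmoothM; apply: csmooth_hdot => //; exact: vsmooth_cst.
Qed.

Lemma vsmooth2_to_pole : vsmooth2 (fun x => to_pole e (v x) (X x)).
Proof.
have [sX1 sX2] := sX; have se := @vsmooth_cst n e.
have sc := csmooth_hdot sv se.
have s1 := csmooth_hdot se sX1; have s2 := csmooth_hdot se sX2.
apply: vsmooth2_qshift; apply: csmooth_div_qdenom.
  by apply: csmoothB; [exact: csmoothM | exact: csmooth_conj].
by apply: csmoothD; [exact: csmooth_conj | exact: csmoothM].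
Qed.

Lemma vsmooth2_from_pole : vsmooth2 (fun x => from_pole e (v x) (X x)).
Proof.
have [sX1 sX2] := sX; have se := @vsmooth_cst n e.
have sc := csmooth_hdot sv se.
have s1 := csmooth_hdot sv sX1; have s2 := csmooth_hdot sv sX2.
apply: vsmooth2_qshift; apply: csmooth_div_qdenom.
  by apply: csmoothB => //; apply: csmoothM => //; exact: csmooth_conj.
by apply: csmoothD => //; apply: csmoothM => //; exact: csmooth_conj.
Qed.

Lemma smooth_realify d (ed : (n + n)%N = d) : smooth (fun x => realify ed (v x)).
Proof.
apply: smooth_rV => j.
rewrite (_ : (fun _ => _) = fun x => match fintype.split (cast_ord (esym ed) j) with
         | inl a => complex.Re (v x a 0)
         | inr a => complex.Im (v x a 0)
         end); last by apply/funext => x; rewrite mxE.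
by case: fintype.split => a; have [] := sv a.
Qed.

Lemma vsmooth_complexify d (ed : (n + n)%N = d) (f : V -> 'rV[R]_d) :
  (forall j, smooth (fun x => f x 0 j)) -> vsmooth (fun x => complexify ed (f x)).
Proof.
move=> sf a; split.
  rewrite (_ : (fun _ => _) = fun x => f x 0 (cast_ord ed (lshift n a))) //.
  by apply/funext => x; rewrite mxE.
rewrite (_ : (fun _ => _) = fun x => f x 0 (cast_ord ed (rshift n a))) //.
by apply/funext => x; rewrite mxE.
Qed.

End SmoothVectors.

Lemma smooth_coord1 (R : realType) (d1 d2 : nat) j :
  smooth (fun p : 'rV[R]_d1.+1 * 'rV[R]_d2.+1 => p.1 0 j).
Proof.
move=> k; apply: Ck_linear => [a x y|x]; first by rewrite !mxE.
apply: (@continuous_comp _ _ _ fst (fun u : 'rV[R]_d1.+1 => u 0 j)).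
  exact: cvg_fst.
exact: coord_continuous.
Qed.

Lemma smooth_coord2 (R : realType) (d1 d2 : nat) j :
  smooth (fun p : 'rV[R]_d1.+1 * 'rV[R]_d2.+1 => p.2 0 j).
Proof.
move=> k; apply: Ck_linear => [a x y|x]; first by rewrite !mxE.
apply: (@continuous_comp _ _ _ snd (fun u : 'rV[R]_d2.+1 => u 0 j)).
  exact: cvg_snd.
exact: coord_continuous.
Qed.

(** * Transport of the model action to the product of spheres *)

Section SphereAction.
Context {R : realType} {m d1 d2 : nat}.
Variables (hd1 : (m.+1 + m.+1)%N = d1.+1) (hd2 : ((m + m) + (m + m))%N = d2.+1).
Variable G : set 'M[R[i]]_m.+1.

Local Notation V := ('rV[R]_d1.+1 * 'rV[R]_d2.+1)%type.
Local Notation M :=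
  ('cV[R[i]]_(1 + m) * ('cV[R[i]]_(1 + m) * 'cV[R[i]]_(1 + m)))%type.

(** With the first basis vector as [e], the orthogonal complement is the last [m] coordinates; the
    dimension [1 + m] suits the block operations. *)
Definition pole : 'cV[R[i]]_(1 + m) := delta_mx 0 0.

Lemma hdot_pole (w : 'cV[R[i]]_(1 + m)) : hdot pole w = w 0 0.
Proof.
rewrite /hdot (bigD1 0)//= big1 => [|i /negPf i0]; rewrite mxE ?eqxx ?i0 /=.
  by rewrite rmorph1 mul1r addr0.
by rewrite rmorph0 mul0r.
Qed.

(** The halves of [y] are the two complex parts of a vector of [H^m]; the zero put on top of each
    makes it orthogonal to [pole]. *)
Definition encode (p : V) : M :=
  let y := complexify hd2 p.2 in
  (complexify hd1 p.1, (col_mx 0 (usubmx y), col_mx 0 (dsubmx y))).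

Definition decode (p : M) : V :=
  (realify hd1 p.1, realify hd2 (col_mx (dsubmx p.2.1) (dsubmx p.2.2))).

Lemma encodeK : cancel encode decode.
Proof.
case=> x y; rewrite /decode /= complexifyK !col_mxKd vsubmxK.
by congr pair; exact: complexifyK.
Qed.

Lemma orthogonal_pole (w : 'cV[R[i]]_(1 + m)) :
  hdot pole w = 0 -> col_mx 0 (dsubmx w) = w.
Proof.
rewrite hdot_pole => w0; rewrite -[RHS]vsubmxK; congr col_mx.
apply/matrixP => i j; rewrite !ord1 !mxE -[LHS]w0; congr (w _ _); exact/val_inj.
Qed.

(** The entries that [decode] drops are the products with [pole], which vanish on the model. *)
Lemma decodeK p : model pole p -> encode (decode p) = p.
Proof.
case: p => v [w1 w2] [/= _ [/= h1 h2] _]; rewrite /encode /= !realifyK.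
by rewrite col_mxKu col_mxKd !orthogonal_pole.
Qed.

Lemma hdot_col_mx k l (a : 'cV[R[i]]_k) (b : 'cV[R[i]]_l) :
  hdot (col_mx a b) (col_mx a b) = hdot a a + hdot b b.
Proof.
rewrite /hdot big_split_ord /=.
by congr (_ + _); apply: eq_bigr => i _; rewrite ?col_mxEu ?col_mxEd.
Qed.

Lemma model_encode p :
  (sphere R d1 `*` sphere R d2) p <-> model pole (encode p).
Proof.
have h0 k : hdot (0 : 'cV[R[i]]_k) 0 = 0 by apply/eqP; rewrite hdot_eq0.
have E2 : hdot2 (encode p).2 = hdot (complexify hd2 p.2) (complexify hd2 p.2).
  by rewrite /hdot2 /= !hdot_col_mx !h0 !add0r -hdot_col_mx vsubmxK.
split=> [[/= /(sphereP hd1) s1 /(sphereP hd2) s2]|[/= s1 _ s2]].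
  split; rewrite ?E2//=.
  by split; rewrite hdot_pole mxE; case: fintype.splitP => // j _; rewrite mxE.
by split; [exact/(sphereP hd1) | apply/(sphereP hd2); rewrite -E2].
Qed.

Lemma smooth_sphere_action (g : 'M[R[i]]_(1 + m)) :
  smooth (fun p => decode (model_act pole g (encode p))).
Proof.
have s1 : vsmooth (fun p : V => (encode p).1).
  by apply: vsmooth_complexify => j; exact: smooth_coord1.
have s2 : vsmooth (fun p : V => complexify hd2 p.2).
  by apply: vsmooth_complexify => j; exact: smooth_coord2.
have s0 (F : V -> 'cV[R[i]]_m) : vsmooth F ->
    vsmooth (fun p => col_mx (0 : 'cV_1) (F p)).
  move=> sF a; case: (split_ordP a) => b ->.
    rewrite (_ : (fun _ => _) = fun=> 0); first exact: csmooth_cst.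
    by apply/funext => x; rewrite col_mxEu mxE.
  rewrite (_ : (fun _ => _) = fun x => F x b 0) //.
  by apply/funext => x; rewrite col_mxEd.
have sY : vsmooth2 (fun p : V => (encode p).2).
  split; apply: s0 => a.
    rewrite (_ : (fun _ => _) = fun x : V => complexify hd2 x.2 (lshift m a) 0) //.
    by apply/funext => x; rewrite mxE.
  rewrite (_ : (fun _ => _) = fun x : V => complexify hd2 x.2 (rshift m a) 0) //.
  by apply/funext => x; rewrite mxE.
have [sX1 sX2] := vsmooth2_from_pole pole s1 sY.
have sg1 := vsmooth_mulmx g s1.
have sgX : vsmooth2 (fun p : V => mulmx2 g (from_pole pole (encode p).1 (encode p).2)).
  by split; exact: vsmooth_mulmx.
have [sW1 sW2] := vsmooth2_to_pole pole sg1 sgX.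
move=> k; apply: Ck_pair; apply: smooth_realify; first exact: sg1.
move=> a; case: (split_ordP a) => b ->.
  rewrite (_ : (fun _ => _) = fun p : V =>
    (model_act pole g (encode p)).2.1 (rshift 1 b) 0) //.
  by apply/funext => x; rewrite col_mxEu mxE.
rewrite (_ : (fun _ => _) = fun p : V =>
  (model_act pole g (encode p)).2.2 (rshift 1 b) 0) //.
by apply/funext => x; rewrite col_mxEd mxE.
Qed.

Lemma sphere_product_action :
  G `<=` unitary_group R m.+1 -> fixes_no_2frame G ->
  acts_freely_smoothly G (sphere R d1 `*` sphere R d2).
Proof.
move=> GU nofix.
have pole1 : hdot pole pole = 1 by rewrite hdot_pole mxE.
exists (fun g p => decode (model_act pole g (encode p))); split.
- move=> g p Gg /model_encode Mp; apply/model_encode.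
  have Mgp := model_act_closed pole1 (GU _ Gg) Mp.
  by rewrite decodeK.
- by move=> p /model_encode Mp; rewrite model_act1// encodeK.
- move=> g h p Gg Gh /model_encode Mp.
  by rewrite decodeK ?model_actM//; [exact: GU | exact: model_act_closed (GU _ Gh) Mp].
- by move=> g Gg; apply: smooth_restrict; exact: smooth_sphere_action.
move=> g p Gg /model_encode Mp gp.
have gEp : model_act pole g (encode p) = encode p.
  by rewrite -[in RHS]gp decodeK//; exact: model_act_closed (GU _ Gg) Mp.
have [w [w1 vw gv gw]] := model_act_free pole1 (GU _ Gg) Mp gEp.
by apply: (nofix g (encode p).1 w) => //; case: Mp.
Qed.

End SphereAction.

Theorem theorem1p1 (R : realType) :
  (forall (n : nat) (G : set 'M[R[i]]_n),
      is_subgroup (unitary_group R n) G -> finite_set G -> has_fixity G 1 ->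
      acts_freely_smoothly G (sphere R (2 * n - 1) `*` sphere R (4 * n - 5))) /\
  (forall G : set 'M[R[i]]_3,
      is_subgroup (special_unitary_group R 3) G -> finite_set G ->
      acts_freely_smoothly G (sphere R 5 `*` sphere R 7)).
Proof.
split=> [[|m] G subG _ fixG|G subG _]; first by case: fixG.
  (* For [m = 0] the truncated [4 * 1 - 5] is 0 and [4 m = d2 + 1] would fail; with [m > 0] both
     dimension equations hold. *)
  have m0 : (0 < m)%N by case: fixG.
  apply: sphere_product_action; [lia | lia | by case: subG |].
  exact: fixity1_no_2frame.
(* Here [m = 2], and the dimension equations read [3 + 3 = 5 + 1] and [4 + 4 = 7 + 1]. *)
apply: (@sphere_product_action R 2) => // [g|]; last exact: SU3_no_2frame.
by case: subG => GU _ _ _ /GU[].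
Qed.
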